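(* Let $(\mathcal C,p)$ and $(\mathcal C',p')$ be universe categories each equipped with a locally cartesian closed structure and a binary product structure, and let ${\bf\Phi}=(\Phi,\phi,\widetilde\phi):(\mathcal C,p)\to(\mathcal C',p')$ be a universe category functor (no compatibility of $\Phi$ with the locally cartesian closed or binary product structures is assumed). For $n\ge0$ and $Y\in\mathcal C$ set $$\chi_{{\bf\Phi},n}(Y)=\eta_n({\bf\Phi}^n(Id^n_Y)):\Phi(I_p^n(Y))\to I_{p'}^n(\Phi(Y)).$$ Then for every $g:Y\to Y'$ one has $$\chi_{{\bf\Phi},n}(Y)\circ I_{p'}^n(\Phi(g))=\Phi(I_p^n(g))\circ\chi_{{\bf\Phi},n}(Y').$$
   Context: Conventions. Composition is written in diagrammatic order: for $f:X\to Y$, $g:Y\to Z$ the composite is $f\circ g:X\to Z$. $\amalg_{i\in I}A_i$ denotes the set of pairs $(i,a)$, $i\in I$, $a\in A_i$. All constructions below for $(\mathcal C,p)$ are applied also to $(\mathcal C',p')$. Universes. A universe in a category $\mathcal C$ is a morphism $p:\widetilde U\to U$ with a choice, for every $F:X\to U$, of a pullback square with vertex $(X;F)$ and projections $p_F:(X;F)\to X$, $Q(F):(X;F)\to\widetilde U$, $p_F\circ F=Q(F)\circ p$. For $f:X'\to X$ and $F:X\to U$, $Q(f,F):(X';f\circ F)\to(X;F)$ is the unique morphism with $Q(f,F)\circ p_F=p_{f\circ F}\circ f$ and $Q(f,F)\circ Q(F)=Q(f\circ F)$. A universe category $(\mathcal C,p)$ is a category with a universe $p$ and a chosen final object $pt$.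 Sets $D_p^n(X,Y)$. $D_p^0(X,Y)=Mor_{\mathcal C}(X,Y)$ and $D_p^{n}(X,Y)=\amalg_{F:X\to U}D_p^{n-1}((X;F),Y)$ for $n\ge1$. For $d\in D_p^n(X,Y)$, $f:X'\to X$, $g:Y\to Y'$, elements $f\circ d\in D_p^n(X',Y)$ and $d\circ g\in D_p^n(X,Y')$ are given by composition in $\mathcal C$ for $n=0$ and, for $n\ge1$, by $f\circ(F,a)=(f\circ F,Q(f,F)\circ a)$, $(F,a)\circ g=(F,a\circ g)$. Locally cartesian closed structure, $I_p$ and $\eta_n$. A binary product structure on $\mathcal C$ is a choice of binary products $X\times Y$ with projections $pr_1,pr_2$. A locally cartesian closed structure is a choice, in each slice $\mathcal C/Z$, of binary products $(X,f)\times_Z(Y,g)$ and of internal-hom objects $\underline{Hom}_Z((X,f),(Y,g))$ with evaluation morphisms $ev:\underline{Hom}_Z((X,f),(Y,g))\times_Z(X,f)\to(Y,g)$ such that $u\mapsto(u\times_Z Id)\circ ev$ is a bijection $Mor_Z((W,h),\underline{Hom}_Z((X,f),(Y,g)))\to Mor_Z((W,h)\times_Z(X,f),(Y,g))$; for $b:(Y,g)\to(Y',g')$ over $Z$, $\underline{Hom}_Z((X,f),b)$ is the unique morphism over $Z$ with $(\underline{Hom}_Z((X,f),b)\times_Z Id)\circ ev=ev\circ b$. Set $I_p(Y)=\underline{Hom}_U((\widetilde U,p),(U\times Y,pr_1))$, with structure morphism $prI_p(Y):I_p(Y)\to U$ and evaluation $evI_p(Y):(I_p(Y),prI_p(Y))\times_U(\widetilde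 U,p)\to U\times Y$; for $f:Y\to Y'$, $I_p(f)=\underline{Hom}_U((\widetilde U,p),Id_U\times f)$. This makes $I_p$ a functor $\mathcal C\to\mathcal C$; $I_p^n$ is its $n$-th iterate. For $F:X\to U$ let $\iota_F:(X;F)\to(X,F)\times_U(\widetilde U,p)$ be the unique morphism with $\iota_F\circ pr_1=p_F$, $\iota_F\circ pr_2=Q(F)$. Set $st_p(Y)=\iota_{prI_p(Y)}\circ evI_p(Y)\circ pr_2:(I_p(Y);prI_p(Y))\to Y$. The function $Mor_{\mathcal C}(X,I_p(Y))\to D_p^1(X,Y)$, $g\mapsto(g\circ prI_p(Y),Q(g,prI_p(Y))\circ st_p(Y))$, is a bijection; $\eta_{1,Y,X}$ denotes its inverse. Bijections $\eta_{n,Y,X}:D_p^n(X,Y)\to Mor_{\mathcal C}(X,I_p^n(Y))$ are given by $\eta_{0,Y,X}=Id$ and $\eta_{n+1,Y,X}(F,a)=\eta_{1,I_p^n(Y),X}(F,\eta_{n,Y,(X;F)}(a))$; indices $Y,X$ are omitted. Set $Id^n_Y=\eta_n^{-1}(Id_{I_p^n(Y)})\in D_p^n(I_p^n(Y),Y)$. Universe category functors. A universe category functor ${\bf\Phi}=(\Phi,\phi,\widetilde\phi):(\mathcal C,p)\to(\mathcal C',p')$ (with $p:\widetilde U\to U$, $p':\widetilde U'\to U'$) consists of a functor $\Phi:\mathcal C\to\mathcal C'$ and morphisms $\phi:\Phi(U)\to U'$, $\widetilde\phi:\Phi(\widetilde U)\to\widetilde U'$ such that $\Phi(pt)$ is final,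 $\Phi$ takes the chosen pullback squares of the universe $p$ to pullback squares, and the square $\widetilde\phi\circ p'=\Phi(p)\circ\phi$ is a pullback. For $F:X\to U$, $\iota_{\bf\Phi}^{X,F}:(\Phi(X);\Phi(F)\circ\phi)\to\Phi((X;F))$ is the unique morphism (an isomorphism) with $\iota_{\bf\Phi}^{X,F}\circ\Phi(p_F)=p_{\Phi(F)\circ\phi}$ and $\iota_{\bf\Phi}^{X,F}\circ\Phi(Q(F))\circ\widetilde\phi=Q(\Phi(F)\circ\phi)$. Functions ${\bf\Phi}^n:D_p^n(X,Y)\to D_{p'}^n(\Phi(X),\Phi(Y))$ are given by ${\bf\Phi}^0(f)=\Phi(f)$ and ${\bf\Phi}^n((F,a))=(\Phi(F)\circ\phi,\iota_{\bf\Phi}^{X,F}\circ{\bf\Phi}^{n-1}(a))$ for $n\ge1$. *)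

(* Defs.v *)
From Stdlib Require Import ClassicalEpsilon ProofIrrelevance.
From mathcomp Require Import ssreflect ssrfun ssrbool.

Set Implicit Arguments.
Unset Strict Implicit.
Unset Printing Implicit Defensive.

(* Unique existence is a proposition below; the unique element is extracted
   by definite description. *)
Definition the (A : Type) (P : A -> Prop) (h : exists! x, P x) : A :=
  proj1_sig (constructive_indefinite_description (unique P) h).

Lemma the_spec A (P : A -> Prop) (h : exists! x, P x) : P (the h).
Proof. by rewrite /the; case: constructive_indefinite_description => x []. Qed.

Lemma the_uniq A (P : A -> Prop) (h : exists! x, P x) y : P y -> y = the h.
Proof.
by rewrite /the; case: constructive_indefinite_description => x [_ u] /= /u.
Qed.

Lemma bijective_ex A B (f : A -> B) : bijective f ->
  exists g : B -> A, cancel f g /\ cancel g f.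
Proof. by case=> g fK gK; exists g. Qed.

Definition bij_inv A B (f : A -> B) (bf : bijective f) : B -> A :=
  proj1_sig (constructive_indefinite_description _ (bijective_ex bf)).

Lemma bij_invK A B (f : A -> B) (bf : bijective f) : cancel f (bij_inv bf).
Proof. by rewrite /bij_inv; case: constructive_indefinite_description => g []. Qed.

Lemma bij_invVK A B (f : A -> B) (bf : bijective f) : cancel (bij_inv bf) f.
Proof. by rewrite /bij_inv; case: constructive_indefinite_description => g []. Qed.

Lemma inj_surj_bij A B (f : A -> B) :
  injective f -> (forall b, exists a, f a = b) -> bijective f.
Proof.
move=> fI fS.
pose g b := proj1_sig (constructive_indefinite_description _ (fS b)).
have gK : cancel g f.
  by move=> b; rewrite /g; case: constructive_indefinite_description.
by exists g => // a; apply: fI; rewrite gK.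
Qed.

Declare Scope cat_scope.
Delimit Scope cat_scope with cat.
Local Open Scope cat_scope.

Reserved Notation "X ~> Y" (at level 90, right associativity).
Reserved Notation "f ;; g" (at level 45, left associativity).

(* Composition is written in diagrammatic order: [f ;; g] is "f, then g". *)
Record category := Category {
  ob :> Type;
  hom : ob -> ob -> Type where "X ~> Y" := (hom X Y);
  idc : forall X, X ~> X;
  comp : forall X Y Z, (X ~> Y) -> (Y ~> Z) -> (X ~> Z)
    where "f ;; g" := (comp f g);
  comp_idl : forall X Y (f : X ~> Y), idc X ;; f = f;
  comp_idr : forall X Y (f : X ~> Y), f ;; idc Y = f;
  comp_assoc : forall X Y Z T (f : X ~> Y) (g : Y ~> Z) (h : Z ~> T),
    f ;; (g ;; h) = (f ;; g) ;; h
}.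
Arguments idc {c} X.
Arguments comp {c X Y Z} f g.

Notation "X ~> Y" := (hom X Y) : cat_scope.
Notation "f ;; g" := (comp f g) : cat_scope.

Record functor (C D : category) := Functor {
  fob :> C -> D;
  fmap : forall X Y, (X ~> Y) -> (fob X ~> fob Y);
  fmap_id : forall X, fmap (idc X) = idc (fob X);
  fmap_comp : forall X Y Z (f : X ~> Y) (g : Y ~> Z),
    fmap (f ;; g) = fmap f ;; fmap g
}.
Arguments fmap {C D} F {X Y} f : rename.

Definition functor_id (C : category) : functor C C :=
  @Functor C C (fun X => X) (fun X Y f => f)
    (fun X => erefl) (fun X Y Z f g => erefl).

Program Definition functor_comp (C D E : category) (F : functor C D)
    (G : functor D E) : functor C E :=
  @Functor C E (fun X => G (F X)) (fun X Y f => fmap G (fmap F f)) _ _.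
Next Obligation. by rewrite !fmap_id. Qed.
Next Obligation. by rewrite !fmap_comp. Qed.

Fixpoint functor_iter (C : category) (F : functor C C) (n : nat) : functor C C :=
  match n with
  | 0 => functor_id C
  | S m => functor_comp (functor_iter F m) F
  end.

Definition is_final (C : category) (X : C) : Prop :=
  forall Y : C, exists! f : Y ~> X, True.

(*      W --b--> Y
        |a       |g
        X --f--> Z      *)
Definition is_pullback (C : category) (W X Y Z : C)
    (a : W ~> X) (b : W ~> Y) (f : X ~> Z) (g : Y ~> Z) : Prop :=
  a ;; f = b ;; g /\
  forall (T : C) (u : T ~> X) (v : T ~> Y), u ;; f = v ;; g ->
    exists! w : T ~> W, w ;; a = u /\ w ;; b = v.

Section Pullback.
Variables (C : category) (W X Y Z : C).
Variables (a : W ~> X) (b : W ~> Y) (f : X ~> Z) (g : Y ~> Z).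
Hypothesis pb : is_pullback a b f g.

Definition pb_lift (T : C) (u : T ~> X) (v : T ~> Y) (e : u ;; f = v ;; g) :
  T ~> W := the (proj2 pb T u v e).

Lemma pb_lift1 T (u : T ~> X) (v : T ~> Y) (e : u ;; f = v ;; g) :
  pb_lift e ;; a = u.
Proof. by case: (the_spec (proj2 pb T u v e)). Qed.

Lemma pb_lift2 T (u : T ~> X) (v : T ~> Y) (e : u ;; f = v ;; g) :
  pb_lift e ;; b = v.
Proof. by case: (the_spec (proj2 pb T u v e)). Qed.

Lemma pb_uniq T (w w' : T ~> W) : w ;; a = w' ;; a -> w ;; b = w' ;; b -> w = w'.
Proof.
move=> ea eb.
have e : (w' ;; a) ;; f = (w' ;; b) ;; g.
  by rewrite -!comp_assoc (proj1 pb).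
have [z [_ zu]] := proj2 pb T _ _ e.
by rewrite -(zu w) // -(zu w').
Qed.
End Pullback.

Record binprods (C : category) := BinProds {
  bprod : C -> C -> C;
  pr1 : forall X Y, bprod X Y ~> X;
  pr2 : forall X Y, bprod X Y ~> Y;
  bprodP : forall (X Y T : C) (u : T ~> X) (v : T ~> Y),
    exists! w : T ~> bprod X Y, w ;; pr1 X Y = u /\ w ;; pr2 X Y = v
}.
Arguments pr1 {C} P X Y : rename.
Arguments pr2 {C} P X Y : rename.

Section BinProds.
Variables (C : category) (P : binprods C).

Definition pair (X Y T : C) (u : T ~> X) (v : T ~> Y) : T ~> bprod P X Y :=
  the (bprodP P u v).

Definition bprod_map (X X' Y Y' : C) (u : X ~> X') (v : Y ~> Y') :
    bprod P X Y ~> bprod P X' Y' :=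
  pair (pr1 P X Y ;; u) (pr2 P X Y ;; v).

Lemma pair1 (X Y T : C) (u : T ~> X) (v : T ~> Y) : pair u v ;; pr1 P X Y = u.
Proof. by case: (the_spec (bprodP P u v)). Qed.

Lemma pair2 (X Y T : C) (u : T ~> X) (v : T ~> Y) : pair u v ;; pr2 P X Y = v.
Proof. by case: (the_spec (bprodP P u v)). Qed.

Lemma pair_uniq (X Y T : C) (w w' : T ~> bprod P X Y) :
  w ;; pr1 P X Y = w' ;; pr1 P X Y -> w ;; pr2 P X Y = w' ;; pr2 P X Y -> w = w'.
Proof.
move=> e1 e2; have [z [_ zu]] := bprodP P (w' ;; pr1 P X Y) (w' ;; pr2 P X Y).
by rewrite -(zu w) // -(zu w').
Qed.

Lemma bprod_map1 (X X' Y Y' : C) (u : X ~> X') (v : Y ~> Y') :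
  bprod_map u v ;; pr1 P X' Y' = pr1 P X Y ;; u.
Proof. exact: pair1. Qed.

Lemma bprod_map2 (X X' Y Y' : C) (u : X ~> X') (v : Y ~> Y') :
  bprod_map u v ;; pr2 P X' Y' = pr2 P X Y ;; v.
Proof. exact: pair2. Qed.

Lemma bprod_map_id (X Y : C) : bprod_map (idc X) (idc Y) = idc (bprod P X Y).
Proof.
by apply: pair_uniq; rewrite ?bprod_map1 ?bprod_map2 !comp_idl comp_idr.
Qed.

Lemma bprod_map_comp (X X' X'' Y Y' Y'' : C) (u : X ~> X') (u' : X' ~> X'')
    (v : Y ~> Y') (v' : Y' ~> Y'') :
  bprod_map (u ;; u') (v ;; v') = bprod_map u v ;; bprod_map u' v'.
Proof.
apply: pair_uniq.
  by rewrite -comp_assoc !bprod_map1 !comp_assoc bprod_map1.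
by rewrite -comp_assoc !bprod_map2 !comp_assoc bprod_map2.
Qed.
End BinProds.

Record ihoms (C : category) (P : binprods C) := IHoms {
  ihom : C -> C -> C;
  ev : forall X Y, bprod P (ihom X Y) X ~> Y;
  ihomP : forall W X Y : C,
    bijective (fun u : W ~> ihom X Y => bprod_map P u (idc X) ;; ev X Y)
}.
Arguments ev {C P} H X Y : rename.

Section IHoms.
Variables (C : category) (P : binprods C) (H : ihoms P).

Definition ihom_map (X Y Y' : C) (b : Y ~> Y') : ihom H X Y ~> ihom H X Y' :=
  bij_inv (ihomP H (ihom H X Y) X Y') (ev H X Y ;; b).

Lemma ihom_mapE (X Y Y' : C) (b : Y ~> Y') :
  bprod_map P (ihom_map X b) (idc X) ;; ev H X Y' = ev H X Y ;; b.
Proof. exact: (bij_invVK (ihomP H (ihom H X Y) X Y')). Qed.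

Lemma ihom_uniq (W X Y : C) (u v : W ~> ihom H X Y) :
  bprod_map P u (idc X) ;; ev H X Y = bprod_map P v (idc X) ;; ev H X Y -> u = v.
Proof. exact: (bij_inj (ihomP H W X Y)). Qed.

Lemma ihom_map_id (X Y : C) : ihom_map X (idc Y) = idc (ihom H X Y).
Proof.
by apply: ihom_uniq; rewrite ihom_mapE bprod_map_id comp_idl comp_idr.
Qed.

Lemma ihom_map_comp (X Y Y' Y'' : C) (b : Y ~> Y') (b' : Y' ~> Y'') :
  ihom_map X (b ;; b') = ihom_map X b ;; ihom_map X b'.
Proof.
apply: ihom_uniq; rewrite ihom_mapE.
rewrite -[in RHS](comp_idl (idc X)) bprod_map_comp -comp_assoc ihom_mapE.
by rewrite !comp_assoc ihom_mapE.
Qed.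
End IHoms.

Section Slice.
Variables (C : category) (Z : C).

(* The eta rule makes [Over (arr A)] convertible to [A]. *)
#[local] Set Primitive Projections.
Record over := Over { dom : C; arr : dom ~> Z }.
#[local] Unset Primitive Projections.

Record over_hom (A B : over) := OverHom {
  over_mor :> dom A ~> dom B;
  over_comm : over_mor ;; arr B = arr A
}.

Lemma over_homP (A B : over) (f g : over_hom A B) :
  over_mor f = over_mor g -> f = g.
Proof.
case: f g => f ef [g eg] /= e; case: _ / e eg => eg.
by rewrite (proof_irrelevance _ ef eg).
Qed.

Program Definition slice : category := @Category over over_hom
  (fun A => @OverHom A A (idc (dom A)) _)
  (fun A B D f g => @OverHom A D (over_mor f ;; over_mor g) _) _ _ _.
Next Obligation. by rewrite comp_idl. Qed.
Next Obligation. by rewrite -comp_assoc !over_comm. Qed.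
Next Obligation. by apply: over_homP; rewrite /= comp_idl. Qed.
Next Obligation. by apply: over_homP; rewrite /= comp_idr. Qed.
Next Obligation.
by apply: over_homP; rewrite /= comp_assoc.
Qed.
End Slice.
Arguments Over {C Z dom} arr.

Record lcc_structure (C : category) := LccStructure {
  lcc_prod : forall Z : C, binprods (slice Z);
  lcc_hom : forall Z : C, ihoms (lcc_prod Z)
}.

Record universe (C : category) := Universe {
  U : C;
  Ut : C;
  p : Ut ~> U;
  ext : forall X : C, (X ~> U) -> C;
  pF : forall (X : C) (F : X ~> U), ext F ~> X;
  qF : forall (X : C) (F : X ~> U), ext F ~> Ut;
  extP : forall (X : C) (F : X ~> U), is_pullback (pF F) (qF F) F p
}.

Record universe_category := UniverseCategory {
  ucat :> category;
  univ :> universe ucat;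
  pt : ucat;
  ptP : is_final pt
}.

Section UniverseOps.
Variables (C : category) (u : universe C).
Local Notation U := (U u).
Local Notation Ut := (Ut u).
Local Notation p := (p u).

Lemma qmor_comm (X' X : C) (f : X' ~> X) (F : X ~> U) :
  (pF (f ;; F) ;; f) ;; F = qF (f ;; F) ;; p.
Proof. by rewrite -comp_assoc; case: (extP (f ;; F)). Qed.

Definition qmor (X' X : C) (f : X' ~> X) (F : X ~> U) :
  ext (f ;; F) ~> ext F := pb_lift (extP F) (qmor_comm f F).

Fixpoint Dp (n : nat) (X Y : C) : Type :=
  match n with
  | 0 => X ~> Y
  | S m => {F : X ~> U & Dp m (ext F) Y}
  end.

Fixpoint Dp_precomp (n : nat) (X' X Y : C) (f : X' ~> X) :
    Dp n X Y -> Dp n X' Y :=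
  match n return Dp n X Y -> Dp n X' Y with
  | 0 => fun d => f ;; d
  | S m => fun d => existT (fun F => Dp m (ext F) Y) (f ;; projT1 d)
      (Dp_precomp (qmor f (projT1 d)) (projT2 d))
  end.

Section Ip.
Variables (L : lcc_structure C) (B : binprods C).

Local Notation PU := (lcc_prod L U).
Local Notation HU := (lcc_hom L U).

Definition p_over : slice U := Over p.
Definition Ux_over (Y : C) : slice U := Over (pr1 B U Y).

Definition Ip_over (Y : C) : slice U := ihom HU p_over (Ux_over Y).
Definition Ip_ob (Y : C) : C := dom (Ip_over Y).
Definition prIp (Y : C) : Ip_ob Y ~> U := arr (Ip_over Y).
Definition evIp (Y : C) : dom (bprod PU (Over (prIp Y)) p_over) ~> bprod B U Y :=
  over_mor (ev HU p_over (Ux_over Y)).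

Lemma Ux_comm (Y Y' : C) (f : Y ~> Y') :
  bprod_map B (idc U) f ;; pr1 B U Y' = pr1 B U Y.
Proof. by rewrite bprod_map1 comp_idr. Qed.

Definition Ux_map (Y Y' : C) (f : Y ~> Y') : Ux_over Y ~> Ux_over Y' :=
  @OverHom C U (Ux_over Y) (Ux_over Y') (bprod_map B (idc U) f) (Ux_comm f).

Definition Ip_map (Y Y' : C) (f : Y ~> Y') : Ip_ob Y ~> Ip_ob Y' :=
  over_mor (ihom_map HU p_over (Ux_map f)).

Lemma Ip_map_id Y : Ip_map (idc Y) = idc (Ip_ob Y).
Proof.
rewrite /Ip_map; have -> : Ux_map (idc Y) = idc (Ux_over Y).
  by apply: over_homP; rewrite /= bprod_map_id.
by rewrite ihom_map_id.
Qed.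

Lemma Ip_map_comp Y Y' Y'' (f : Y ~> Y') (g : Y' ~> Y'') :
  Ip_map (f ;; g) = Ip_map f ;; Ip_map g.
Proof.
rewrite /Ip_map; have -> : Ux_map (f ;; g) = Ux_map f ;; Ux_map g.
  by apply: over_homP; rewrite /= -bprod_map_comp comp_idl.
by rewrite ihom_map_comp.
Qed.

Definition Ip : functor C C := Functor Ip_map_id Ip_map_comp.

Definition Ipn (n : nat) : functor C C := functor_iter Ip n.

Section Iota.
Variables (X : C) (F : X ~> U).

Definition ext_over : slice U := Over (pF F ;; F).

Definition pF_over : ext_over ~> (Over F : slice U) :=
  @OverHom C U ext_over (Over F) (pF F) erefl.

Definition qF_over : ext_over ~> p_over :=
  @OverHom C U ext_over p_over (qF F) (esym (proj1 (extP F))).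

(* A morphism of [C] whose composite with the first projection is [pF F] is
   automatically a morphism over [U], so it makes no difference whether
   uniqueness is understood in [C] or in the slice. *)
Definition iotaF : ext F ~> dom (bprod PU (Over F : slice U) p_over) :=
  over_mor (pair PU pF_over qF_over).

Lemma iotaF1 : iotaF ;; over_mor (pr1 PU (Over F : slice U) p_over) = pF F.
Proof. exact: (f_equal (@over_mor _ _ _ _) (pair1 PU pF_over qF_over)). Qed.

Lemma iotaF2 : iotaF ;; over_mor (pr2 PU (Over F : slice U) p_over) = qF F.
Proof. exact: (f_equal (@over_mor _ _ _ _) (pair2 PU pF_over qF_over)). Qed.

Lemma iotaF_inv : exists j, j ;; iotaF = idc _ /\ iotaF ;; j = idc _.
Proof.
set q1 := pr1 PU (Over F : slice U) p_over.
set q2 := pr2 PU (Over F : slice U) p_over.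
have e : over_mor q1 ;; F = over_mor q2 ;; p.
  by rewrite (over_comm q1) (over_comm q2).
pose j := pb_lift (extP F) e.
have j1 : j ;; pF F = over_mor q1 by apply: pb_lift1.
have j2 : j ;; qF F = over_mor q2 by apply: pb_lift2.
exists j; split; last first.
  apply: (pb_uniq (extP F)); rewrite -comp_assoc comp_idl.
    by rewrite j1 iotaF1.
  by rewrite j2 iotaF2.
have jc : j ;; arr ext_over = arr (bprod PU (Over F : slice U) p_over).
  by rewrite /= comp_assoc j1 (over_comm q1).
pose js := @OverHom C U (bprod PU (Over F : slice U) p_over) ext_over j jc.
pose i : ext_over ~> bprod PU (Over F : slice U) p_over := pair PU pF_over qF_over.
suff /(f_equal (@over_mor _ _ _ _)) : (js : hom (c := slice U) _ _) ;; i = idc _ by [].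
apply: pair_uniq; rewrite comp_idl -comp_assoc ?pair1 ?pair2;
  exact: over_homP.
Qed.
End Iota.

Definition st_p (Y : C) : ext (prIp Y) ~> Y :=
  iotaF (prIp Y) ;; evIp Y ;; pr2 B U Y.

Definition eta1_inv (Y X : C) (g : X ~> Ip Y) : Dp 1 X Y :=
  existT (fun F => ext F ~> Y) (g ;; prIp Y) (qmor g (prIp Y) ;; st_p Y).

Section Eta1.
Variables (X Y : C).

Let uncurry (F : X ~> U) (gh : (Over F : slice U) ~> Ip_over Y) : ext F ~> Y :=
  iotaF F ;; over_mor (bprod_map PU gh (idc p_over) ;; ev HU p_over (Ux_over Y))
    ;; pr2 B U Y.

Lemma qmor_iotaF (g : X ~> Ip_ob Y) :
  qmor g (prIp Y) ;; iotaF (prIp Y) =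
  iotaF (g ;; prIp Y) ;; over_mor (bprod_map PU
    (@OverHom C U (Over (g ;; prIp Y)) (Ip_over Y) g erefl : hom (c := slice U) _ _)
    (idc p_over)).
Proof.
set gh := (X in bprod_map _ X _).
set F := g ;; prIp Y.
have qc : qmor g (prIp Y) ;; arr (ext_over (prIp Y)) = arr (ext_over F).
  by rewrite /= comp_assoc /qmor pb_lift1 -comp_assoc.
pose qs : ext_over F ~> ext_over (prIp Y) :=
  @OverHom C U (ext_over F) (ext_over (prIp Y)) _ qc.
suff /(f_equal (@over_mor _ _ _ _)) :
  qs ;; pair PU (pF_over (prIp Y)) (qF_over (prIp Y)) =
  pair PU (pF_over F) (qF_over F) ;; bprod_map PU gh (idc p_over) by [].
apply: pair_uniq; rewrite -!comp_assoc.
  rewrite bprod_map1 pair1 comp_assoc pair1.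
  by apply: over_homP; rewrite /= /qmor pb_lift1.
rewrite bprod_map2 pair2 comp_assoc pair2 comp_idr.
by apply: over_homP; rewrite /= /qmor pb_lift2.
Qed.

Lemma eta1_invE (F : X ~> U) (gh : (Over F : slice U) ~> Ip_over Y) :
  eta1_inv (over_mor gh : X ~> Ip Y) =
  existT (fun F => ext F ~> Y) F (uncurry gh).
Proof.
case: gh => g /= e; case: _ / e; rewrite /eta1_inv; congr existT.
by rewrite /st_p !comp_assoc qmor_iotaF /uncurry /= !comp_assoc.
Qed.

Lemma eta1_inv_bij : bijective (@eta1_inv Y X).
Proof.
apply: inj_surj_bij.
  move=> g g'.
  rewrite (eta1_invE (@OverHom C U (Over (g ;; prIp Y)) (Ip_over Y) g erefl)).
  rewrite (eta1_invE (@OverHom C U (Over (g' ;; prIp Y)) (Ip_over Y) g' erefl)).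
  set gh := OverHom _; set gh' := OverHom _ => e.
  suff : over_mor gh = over_mor gh' by [].
  move: (g ;; prIp Y) (g' ;; prIp Y) gh gh' e => F F' gh gh' e.
  have eF := f_equal (@projT1 _ _) e; rewrite /= in eF.
  case: _ / eF gh' e => gh' e.
  have {}e := inj_pair2 _ _ _ _ _ e.
  apply: (f_equal (@over_mor _ _ _ _)).
  apply: (@ihom_uniq _ _ HU (Over F) p_over (Ux_over Y) gh gh').
  apply: over_homP; apply: pair_uniq.
    by rewrite !(@over_comm C U _ (Ux_over Y)).
  have [j [ji _]] := iotaF_inv F.
  by move: (f_equal (comp j) e); rewrite /uncurry !comp_assoc ji !comp_idl.
case=> F a; have [j [ji ij]] := iotaF_inv F.
pose E : slice U := bprod PU (Over F : slice U) p_over.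
pose v : E ~> Ux_over Y :=
  @OverHom C U E (Ux_over Y) (pair B (arr E) (j ;; a)) (pair1 _ _ _).
pose gh := bij_inv (ihomP HU (Over F : slice U) p_over (Ux_over Y)) v.
have ghE : bprod_map PU gh (idc p_over) ;; ev HU p_over (Ux_over Y) = v.
  exact: (bij_invVK (ihomP HU (Over F : slice U) p_over (Ux_over Y))).
exists (over_mor gh); rewrite eta1_invE; congr existT; rewrite /uncurry ghE.
by rewrite /= -comp_assoc pair2 comp_assoc ij comp_idl.
Qed.

Definition eta1 : Dp 1 X Y -> (X ~> Ip Y) := bij_inv eta1_inv_bij.
End Eta1.

Fixpoint eta (n : nat) (Y X : C) : Dp n X Y -> (X ~> Ipn n Y) :=
  match n return Dp n X Y -> (X ~> Ipn n Y) with
  | 0 => fun d => d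
  | S m => fun d => @eta1 X (Ipn m Y)
      (existT (fun F => ext F ~> Ipn m Y) (projT1 d) (eta (projT2 d)))
  end.

Lemma eta_bij n Y X : bijective (@eta n Y X).
Proof.
elim: n X => [|n IHn] X; first by exists id.
have eta1K := bij_invK (@eta1_inv_bij X (Ipn n Y)).
have eta1VK := bij_invVK (@eta1_inv_bij X (Ipn n Y)).
apply: inj_surj_bij.
  move=> [F a] [F' a'] /= /(can_inj eta1VK) e.
  have eF := f_equal (@projT1 _ _) e; rewrite /= in eF.
  case: _ / eF a' e => a' e.
  by rewrite (bij_inj (IHn _) (inj_pair2 _ _ _ _ _ e)).
move=> g; case e : (eta1_inv (g : X ~> Ip (Ipn n Y))) => [F b].
exists (existT (fun F => Dp n (ext F) Y) F (bij_inv (IHn _) b)) => /=.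
by rewrite bij_invVK -e; exact: eta1K.
Qed.

Definition Idn (n : nat) (Y : C) : Dp n (Ipn n Y) Y :=
  bij_inv (@eta_bij n Y (Ipn n Y)) (idc (Ipn n Y)).

End Ip.
End UniverseOps.

Record ucat_functor (C C' : universe_category) := UcatFunctor {
  ufun :> functor C C';
  phi : ufun (U C) ~> U C';
  tphi : ufun (Ut C) ~> Ut C';
  Phi_pt : is_final (ufun (pt C));
  Phi_pb : forall (X : C) (F : X ~> U C),
    is_pullback (fmap ufun (pF F)) (fmap ufun (qF F)) (fmap ufun F) (fmap ufun (p C));
  phi_pb : is_pullback (fmap ufun (p C)) tphi phi (p C')
}.

Section UcatFunctor.
Variables (C C' : universe_category) (Phi : ucat_functor C C').

Lemma Phi_ext_pb (X : C) (F : X ~> U C) :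
  is_pullback (fmap Phi (pF F)) (fmap Phi (qF F) ;; tphi Phi)
    (fmap Phi F ;; phi Phi) (p C').
Proof.
have [c1 _] := Phi_pb Phi F; have [c2 _] := phi_pb Phi; split.
  by rewrite comp_assoc c1 -!comp_assoc c2.
move=> T a b e; rewrite comp_assoc in e.
pose w := pb_lift (phi_pb Phi) e.
have w1 : w ;; fmap Phi (p C) = a ;; fmap Phi F by apply: pb_lift1.
have w2 : w ;; tphi Phi = b by apply: pb_lift2.
pose z := pb_lift (Phi_pb Phi F) (esym w1).
have z1 : z ;; fmap Phi (pF F) = a by apply: pb_lift1.
have z2 : z ;; fmap Phi (qF F) = w by apply: pb_lift2.
exists z; split; first by rewrite comp_assoc z2.
move=> z' [z'1 z'2]; apply: (pb_uniq (Phi_pb Phi F)); first by rewrite z1.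
rewrite z2; apply: (pb_uniq (phi_pb Phi)); last by rewrite w2 -comp_assoc.
by rewrite w1 -comp_assoc -c1 comp_assoc z'1.
Qed.

Definition iota_Phi (X : C) (F : X ~> U C) :
    ext (fmap Phi F ;; phi Phi) ~> Phi (ext F) :=
  pb_lift (Phi_ext_pb F) (proj1 (extP (fmap Phi F ;; phi Phi))).

Fixpoint Phi_n (n : nat) (X Y : C) : Dp C n X Y -> Dp C' n (Phi X) (Phi Y) :=
  match n return Dp C n X Y -> Dp C' n (Phi X) (Phi Y) with
  | 0 => fun d => fmap Phi d
  | S m => fun d =>
      existT (fun F' => Dp C' m (ext F') (Phi Y)) (fmap Phi (projT1 d) ;; phi Phi)
        (Dp_precomp (iota_Phi (projT1 d)) (Phi_n (projT2 d)))
  end.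

Variables (L : lcc_structure C) (B : binprods C).
Variables (L' : lcc_structure C') (B' : binprods C').

Definition chi (n : nat) (Y : C) : Phi (Ipn C L B n Y) ~> Ipn C' L' B' n (Phi Y) :=
  eta L' B' (Phi_n (Idn C L B n Y)).

End UcatFunctor.

(* Main.v *)
From mathcomp Require Import ssreflect ssrfun ssrbool.
Require Import Defs.

Set Implicit Arguments.
Unset Strict Implicit.
Unset Printing Implicit Defensive.

Local Open Scope cat_scope.

(** The sets [Dp n X Y] are contravariant in [X] and covariant in [Y], the
    bijections [eta] are natural in both variables ([eta_precomp],
    [eta_postcomp]), and so are the maps [Phi_n] ([Phi_n_precomp],
    [Phi_n_postcomp]).  Writing [*] for the two actions, naturality of [eta]
    applied to [Idn Y = eta^-1 (idc _)] shows that both [Idn Y * g] and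
    [Ipn g * Idn Y'] have image [Ipn g] under the injective map [eta], hence
    they are equal ([Idn_natural]).  Applying [Phi_n] and then [eta] of the
    target category to this equality, and using naturality of both, gives the
    commutation of [chi] with [g].

    The only technical point is that elements of [Dp] are dependent pairs
    whose first components agree only up to the category axioms, for instance
    [(f ;; g) ;; F] and [f ;; (g ;; F)].  All the comparisons needed are
    instances of [existT_precomp_eq], which uses the universal property of a
    pullback instead of transporting along these equalities. *)

(** * Functoriality of the sets Dp *)

Section DpFunctoriality.
Variables (C : category) (u : universe C).

Lemma qmor_pF (X' X : C) (f : X' ~> X) (F : X ~> U u) :
  qmor f F ;; pF F = pF (f ;; F) ;; f.
Proof. exact: pb_lift1. Qed.

Lemma qmor_qF (X' X : C) (f : X' ~> X) (F : X ~> U u) :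
  qmor f F ;; qF F = qF (f ;; F).
Proof. exact: pb_lift2. Qed.

(** Once [F1] and [F2] are identified, [h1] and [h2] have the same components
    into the pullback [E].  Stating the hypotheses through these components
    keeps the types of [h1] and [h2] independent, so that no cast appears when
    [F1 = F2] is a category axiom. *)
Lemma existT_precomp_eq (n : nat) (X1 X E Y : C) (F1 F2 : X1 ~> U u)
    (k : X1 ~> X) (r : E ~> X) (q : E ~> Ut u) (G : X ~> U u)
    (h1 : ext F1 ~> E) (h2 : ext F2 ~> E) (a : Dp u n E Y) :
  is_pullback r q G (p u) -> F1 = F2 ->
  h1 ;; r = pF F1 ;; k -> h1 ;; q = qF F1 ->
  h2 ;; r = pF F2 ;; k -> h2 ;; q = qF F2 ->
  existT (fun F => Dp u n (ext F) Y) F1 (Dp_precomp h1 a) =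
  existT (fun F => Dp u n (ext F) Y) F2 (Dp_precomp h2 a).
Proof.
move=> pb e; case: _ / e h2 => h2 r1 q1 r2 q2.
by rewrite (pb_uniq pb (w := h1) (w' := h2)) ?r1 ?q1.
Qed.

Lemma Dp_precomp_id (n : nat) (X Y : C) (d : Dp u n X Y) :
  Dp_precomp (idc X) d = d.
Proof.
elim: n X d => [|n IHn] X /= d; first exact: comp_idl.
case: d => F a /=; rewrite -[in RHS](IHn _ a).
apply: (existT_precomp_eq (k := idc X) _ (extP F)).
- exact: comp_idl.
- exact: qmor_pF.
- exact: qmor_qF.
- by rewrite comp_idl comp_idr.
- exact: comp_idl.
Qed.

Lemma Dp_precomp_comp (n : nat) (X'' X' X Y : C) (f : X'' ~> X') (g : X' ~> X)
    (d : Dp u n X Y) :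
  Dp_precomp (f ;; g) d = Dp_precomp f (Dp_precomp g d).
Proof.
elim: n X'' X' X f g d => [|n IHn] X'' X' X f g /= d.
  by rewrite comp_assoc.
case: d => F a /=; rewrite -IHn.
apply: (existT_precomp_eq (k := f ;; g) _ (extP F)).
- by rewrite comp_assoc.
- exact: qmor_pF.
- exact: qmor_qF.
- by rewrite -comp_assoc qmor_pF (comp_assoc (qmor _ _)) qmor_pF -comp_assoc.
- by rewrite -comp_assoc !qmor_qF.
Qed.

Fixpoint Dp_postcomp (n : nat) (X Y Y' : C) (g : Y ~> Y') :
    Dp u n X Y -> Dp u n X Y' :=
  match n return Dp u n X Y -> Dp u n X Y' with
  | 0 => fun d => d ;; g
  | S m => fun d => existT (fun F => Dp u m (ext F) Y') (projT1 d)
      (Dp_postcomp g (projT2 d))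
  end.

Lemma Dp_precomp_postcomp (n : nat) (X' X Y Y' : C) (f : X' ~> X)
    (g : Y ~> Y') (d : Dp u n X Y) :
  Dp_precomp f (Dp_postcomp g d) = Dp_postcomp g (Dp_precomp f d).
Proof.
elim: n X' X f d => [|n IHn] X' X f d /=; first by rewrite comp_assoc.
by rewrite IHn.
Qed.

(** * Naturality of the bijections eta *)

Variables (L : lcc_structure C) (B : binprods C).

(** By definition [eta1_inv g] is [g] acting on the fixed element
    [(prIp Y, st_p Y)]; this is functoriality of that action. *)
Lemma eta1_inv_precomp (X' X Y : C) (f : X' ~> X) (g : X ~> Ip u L B Y) :
  eta1_inv (f ;; g) = Dp_precomp f (eta1_inv g).
Proof.
exact: (Dp_precomp_comp (n := 1) f g
  (existT (fun F => ext F ~> Y) (prIp u L B Y) (st_p u L B Y))).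
Qed.

(** [Ip_map g] is the transpose of evaluation followed by [g], and
    [eta1_inv] undoes the transposition. *)
Lemma eta1_inv_Ip_map (Y Y' : C) (g : Y ~> Y') :
  eta1_inv (fmap (Ip u L B) g) =
  existT (fun F => ext F ~> Y') (prIp u L B Y) (st_p u L B Y ;; g).
Proof.
rewrite (eta1_invE (ihom_map (lcc_hom L (U u)) (p_over u) (Ux_map u B g))).
rewrite ihom_mapE; congr existT.
by rewrite /st_p /evIp /= -!comp_assoc bprod_map2.
Qed.

Lemma eta1_inv_postcomp (X Y Y' : C) (h : X ~> Ip u L B Y) (g : Y ~> Y') :
  eta1_inv (h ;; fmap (Ip u L B) g) = Dp_postcomp (n := 1) g (eta1_inv h).
Proof.
by rewrite eta1_inv_precomp eta1_inv_Ip_map /= comp_assoc.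
Qed.

Lemma eta1K (X Y : C) : cancel (@eta1 C u L B X Y) (@eta1_inv C u L B Y X).
Proof. exact: bij_invVK. Qed.

Lemma eta1_invK (X Y : C) : cancel (@eta1_inv C u L B Y X) (@eta1 C u L B X Y).
Proof. exact: bij_invK. Qed.

Lemma eta1_precomp (X' X Y : C) (f : X' ~> X) (d : Dp u 1 X Y) :
  eta1 L B (Dp_precomp f d) = f ;; eta1 L B d.
Proof.
by apply: (can_inj (@eta1_invK _ _)); rewrite eta1_inv_precomp !eta1K.
Qed.

Lemma eta1_postcomp (X Y Y' : C) (g : Y ~> Y') (d : Dp u 1 X Y) :
  eta1 L B (Dp_postcomp g d) = eta1 L B d ;; fmap (Ip u L B) g.
Proof.
by apply: (can_inj (@eta1_invK _ _)); rewrite eta1_inv_postcomp !eta1K.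
Qed.

Lemma eta_precomp (n : nat) (X' X Y : C) (f : X' ~> X) (d : Dp u n X Y) :
  eta L B (Dp_precomp f d) = f ;; eta L B d.
Proof.
elim: n X' X f d => [|n IHn] X' X f //= d.
rewrite IHn; exact: (eta1_precomp f
  (existT (fun F => ext F ~> Ipn u L B n Y) (projT1 d) (eta L B (projT2 d)))).
Qed.

Lemma eta_postcomp (n : nat) (X Y Y' : C) (g : Y ~> Y') (d : Dp u n X Y) :
  eta L B (Dp_postcomp g d) = eta L B d ;; fmap (Ipn u L B n) g.
Proof.
elim: n X d => [|n IHn] X //= d.
rewrite IHn; exact: (eta1_postcomp (fmap (Ipn u L B n) g)
  (existT (fun F => ext F ~> Ipn u L B n Y) (projT1 d) (eta L B (projT2 d)))).
Qed.

Lemma eta_Idn (n : nat) (Y : C) : eta L B (Idn u L B n Y) = idc _.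
Proof. exact: (bij_invVK (@eta_bij C u L B n Y (Ipn u L B n Y))). Qed.

(** Both sides correspond to [Ipn g] under the bijection [eta]. *)
Lemma Idn_natural (n : nat) (Y Y' : C) (g : Y ~> Y') :
  Dp_postcomp g (Idn u L B n Y) =
  Dp_precomp (fmap (Ipn u L B n) g) (Idn u L B n Y').
Proof.
apply: (bij_inj (@eta_bij C u L B n Y' (Ipn u L B n Y))).
by rewrite eta_postcomp eta_precomp !eta_Idn comp_idl comp_idr.
Qed.

End DpFunctoriality.

(** * Naturality of the action of a universe category functor *)

Section PhiNaturality.
Variables (C C' : universe_category) (Phi : ucat_functor C C').

Lemma iota_Phi_pF (X : C) (F : X ~> U C) :
  iota_Phi Phi F ;; fmap Phi (pF F) = pF (fmap Phi F ;; phi Phi).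
Proof. exact: pb_lift1. Qed.

Lemma iota_Phi_qF (X : C) (F : X ~> U C) :
  iota_Phi Phi F ;; (fmap Phi (qF F) ;; tphi Phi) = qF (fmap Phi F ;; phi Phi).
Proof. exact: pb_lift2. Qed.

(** After the inductive hypothesis the claim is the compatibility of
    [iota_Phi] with [qmor], an equality of maps into [Phi (ext F)]; this
    object is a pullback of [p C'] by [Phi_ext_pb]. *)
Lemma Phi_n_precomp (n : nat) (X' X Y : C) (f : X' ~> X) (d : Dp C n X Y) :
  Phi_n Phi (Dp_precomp f d) = Dp_precomp (fmap Phi f) (Phi_n Phi d).
Proof.
elim: n X' X f d => [|n IHn] X' X f /= d; first exact: fmap_comp.
case: d => F a /=; rewrite IHn -!Dp_precomp_comp.
apply: (existT_precomp_eq (k := fmap Phi f) _ (Phi_ext_pb Phi F)).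
- by rewrite fmap_comp comp_assoc.
- rewrite -comp_assoc -fmap_comp qmor_pF (fmap_comp _ (pF _)) comp_assoc.
  by rewrite iota_Phi_pF.
- rewrite -comp_assoc (comp_assoc _ (fmap Phi (qF F))) -fmap_comp qmor_qF.
  exact: iota_Phi_qF.
- by rewrite -comp_assoc iota_Phi_pF qmor_pF.
- by rewrite -comp_assoc iota_Phi_qF qmor_qF.
Qed.

Lemma Phi_n_postcomp (n : nat) (X Y Y' : C) (g : Y ~> Y') (d : Dp C n X Y) :
  Phi_n Phi (Dp_postcomp g d) = Dp_postcomp (fmap Phi g) (Phi_n Phi d).
Proof.
elim: n X d => [|n IHn] X /= d; first exact: fmap_comp.
by rewrite IHn Dp_precomp_postcomp.
Qed.

End PhiNaturality.

Theorem mainTheorem16 (C C' : universe_category)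
    (L : lcc_structure C) (B : binprods C)
    (L' : lcc_structure C') (B' : binprods C')
    (Phi : ucat_functor C C') (n : nat) (Y Y' : C) (g : Y ~> Y') :
  chi Phi L B L' B' n Y ;; fmap (Ipn C' L' B' n) (fmap Phi g) =
  fmap Phi (fmap (Ipn C L B n) g) ;; chi Phi L B L' B' n Y'.
Proof.
rewrite /chi -eta_postcomp -Phi_n_postcomp Idn_natural.
by rewrite Phi_n_precomp eta_precomp.
Qed.
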